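(* Let $n \geq 2$, let $V = (V_1, \ldots, V_n)$ be an $n$-tuple of doubly commuting isometries on a Hilbert space $\mathcal{H}$, and let $m \in \{2, \ldots, n\}$. Then there exist $2^m$ joint $(V_1, \ldots, V_m)$-reducing subspaces $\{\mathcal{H}_A : A \subseteq I_m\}$ of $\mathcal{H}$ (some of which may be the trivial subspace $\{0\}$) such that $$\mathcal{H} = \bigoplus_{A \subseteq I_m} \mathcal{H}_A$$ (orthogonal direct sum), where for each $A \subseteq I_m$, $$\mathcal{H}_A = \bigoplus_{\boldsymbol{k} \in \mathbb{N}^A} V_A^{\boldsymbol{k}} \Big( \bigcap_{\boldsymbol{j} \in \mathbb{N}^{I_m \setminus A}} V_{I_m \setminus A}^{\boldsymbol{j}} \mathcal{W}_A \Big)$$ (orthogonal direct sum). In particular (case $m = n$), there exist $2^n$ pairwise orthogonal joint $V$-reducing subspaces $\{\mathcal{H}_A : A \subseteq I_n\}$ such that $\mathcal{H} = \bigoplus_{A \subseteq I_n} \mathcal{H}_A$, and for each $A \subseteq I_n$ with $\mathcal{H}_A \neq \{0\}$ and each $i = 1, \ldots, n$, the restriction $V_i|_{\mathcal{H}_A}$ is a shift if $i \in A$ and is unitary if $i \in I_n \setminus A$. Moreover, this last decomposition is unique: if $\{\mathcal{H}_A : A \subseteq I_n\}$ is any family of pairwise orthogonal joint $V$-reducing subspaces with $\mathcal{H} = \bigoplus_{A \subseteq I_n} \mathcal{H}_A$ such that, for every $A$ with $\mathcal{H}_A \ne \{0\}$, $V_i|_{\mathcal{H}_A}$ is a shift for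 $i \in A$ and unitary for $i \in I_n \setminus A$, then $$\mathcal{H}_A = \bigoplus_{\boldsymbol{k} \in \mathbb{N}^A} V_A^{\boldsymbol{k}} \Big( \bigcap_{\boldsymbol{j} \in \mathbb{N}^{I_n \setminus A}} V_{I_n \setminus A}^{\boldsymbol{j}} \mathcal{W}_A \Big) \quad \text{for all } A \subseteq I_n.$$
   Context: An $n$-tuple $V = (V_1, \ldots, V_n)$ of commuting isometries on a Hilbert space $\mathcal{H}$ is doubly commuting if $V_i V_j^* = V_j^* V_i$ for all $1 \leq i < j \leq n$. A closed subspace is reducing for an operator $T$ if it is invariant under $T$ and $T^*$; it is joint $(V_1, \ldots, V_m)$-reducing if it is reducing for each $V_i$, $1 \le i \le m$, and joint $V$-reducing if it is reducing for each of $V_1, \ldots, V_n$. A closed subspace $\mathcal{W}$ is wandering for an isometry $T$ on $\mathcal{H}$ if $T^k \mathcal{W} \perp T^l \mathcal{W}$ for all $k \neq l$ in $\mathbb{N}$. An isometry $T$ on $\mathcal{H}$ is a shift if $\mathcal{H} = \bigoplus_{k \geq 0} T^k \mathcal{W}$ for some wandering subspace $\mathcal{W}$ for $T$. Notation: $\mathbb{N} = \{0, 1, 2, \ldots\}$; $I_m = \{1, \ldots, m\}$. For $A = \{i_1, \ldots, i_l\} \subseteq I_m$, $\mathbb{N}^A = \{\boldsymbol{k} = (k_{i_1}, \ldots, k_{i_l}) : k_{i_j} \in \mathbb{N}\}$ and $V_A^{\boldsymbol{k}} = V_{i_1}^{k_{i_1}} \cdots V_{i_l}^{k_{i_l}}$.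 For $A = \emptyset$, $\mathbb{N}^A$ has a single (empty) element and $V_A^{\boldsymbol{k}}$ is the identity. For non-empty $A$, $\mathcal{W}_A = \operatorname{ran}\big(\prod_{i \in A} (I - V_i V_i^* )\big)$; also $\mathcal{W}_\emptyset = \mathcal{H}$. Thus $\mathcal{H}_\emptyset = \bigcap_{\boldsymbol{j} \in \mathbb{N}^{I_m}} V_{I_m}^{\boldsymbol{j}} \mathcal{H}$ and $\mathcal{H}_{I_m} = \bigoplus_{\boldsymbol{k} \in \mathbb{N}^{I_m}} V_{I_m}^{\boldsymbol{k}} \mathcal{W}_{I_m}$. *)

(* Defs.v *)
From HB Require Import structures.
From mathcomp Require Import all_boot all_order all_algebra.
From mathcomp Require Import complex.
From mathcomp Require Import mathcomp_extra boolp classical_sets functions.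
From mathcomp Require Import reals topology normedtype.

Set Implicit Arguments.
Unset Strict Implicit.
Unset Printing Implicit Defensive.

Import Order.TTheory GRing.Theory Num.Theory.
Import numFieldNormedType.Exports.

Local Open Scope classical_set_scope.
Local Open Scope complex_scope.
Local Open Scope ring_scope.

(* A complex Hilbert space: a Banach space over R[i] whose norm comes from an
   inner product, linear in its first argument. *)
HB.mixin Record CompleteNormedModule_isHilbert (R : realType) H
    of CompleteNormedModule R[i] H := {
  inner : {dot H for Num.conj} ;
  inner_normE : forall x : H, `|x| ^+ 2 = inner x x }.

#[short(type="hilbertType")]
HB.structure Definition Hilbert (R : realType) :=
  {H of CompleteNormedModule_isHilbert R H & CompleteNormedModule R[i] H}.

Section HilbertSpace.
Variables (R : realType) (H : hilbertType R).
Implicit Types (X Y W : set H) (T : H -> H).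

Definition closed_subspace X := submod_closed (mem X) /\ closed X.

Definition orthogonal_sets X Y :=
  forall x y, X x -> Y y -> inner x y = 0.

Definition closed_span X : set H := smallest closed_subspace X.

(* X is the orthogonal (Hilbert space) direct sum of the closed subspaces F i;
   I may be infinite, hence the closed span. *)
Definition orthogonal_dsum (I : Type) (F : I -> set H) X :=
  [/\ forall i, closed_subspace (F i),
      forall i j, i <> j -> orthogonal_sets (F i) (F j)
    & X = closed_span (\bigcup_i F i)].

(* The Hilbert space adjoint; for a bounded linear T the vector z below exists
   (Riesz) and is unique, so the default value 0 is never used. *)
Definition adjoint T : H -> H :=
  fun y => xget 0 [set z | forall x, inner (T x) y = inner x z].

Definition reducing T X :=
  [/\ closed_subspace X, T @` X `<=` X & adjoint T @` X `<=` X].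

(* The predicates "_on X" concern the restriction of T to X. *)
Definition isometry_on X T :=
  T @` X `<=` X /\ (forall x, X x -> `|T x| = `|x|).

Definition unitary_on X T :=
  set_bij X X T /\
  (forall x y, X x -> X y -> inner (T x) (T y) = inner x y).

Definition wandering T W :=
  closed_subspace W /\
  (forall k l : nat, k <> l ->
     orthogonal_sets (iter k T @` W) (iter l T @` W)).

Definition shift_on X T :=
  isometry_on X T /\
  exists W, [/\ W `<=` X, wandering T W
              & orthogonal_dsum (fun k : nat => iter k T @` W) X].

Section Tuples.
Variables (m : nat) (V : 'I_m -> {linear H -> H}).
Implicit Types A : {set 'I_m}.

Definition doubly_commuting_isometries :=
  [/\ forall i, isometry_on setT (V i),
      forall i j, V i \o V j = V j \o V i
    & forall i j : 'I_m, (i < j)%N ->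
        V i \o adjoint (V j) = adjoint (V j) \o V i].

Definition jointly_reducing X := forall i, reducing (V i) X.

(* The set of multi-indices N^A, functions from the elements of A to nat. *)
Definition multi_index A := {ffun {i | i \in A} -> nat}.

Definition multi_power A (k : multi_index A) : H -> H :=
  \big[comp/id]_(i : {i | i \in A}) iter (k i) (V (val i)).

(* The range of the product over i in A of I - V_i V_i^*; it is setT if A is
   empty. *)
Definition wandering_range A : set H :=
  range (\big[comp/id]_(i in A) (fun x => x - V i (adjoint (V i) x))).

Definition unitary_core A : set H :=
  \bigcap_(j in [set: multi_index (~: A)])
     (multi_power j @` wandering_range A).

Definition wold_component A X :=
  orthogonal_dsum (fun k : multi_index A => multi_power k @` unitary_core A) X.

Definition shift_unitary_decomposition (HA : {set 'I_m} -> set H) :=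
  [/\ forall A, jointly_reducing (HA A),
      orthogonal_dsum HA setT
    & forall A, HA A <> [set 0] -> forall i,
        (i \in A -> shift_on (HA A) (V i)) /\
        (i \notin A -> unitary_on (HA A) (V i))].

End Tuples.

End HilbertSpace.

(* Main.v *)
(* The Wold decomposition of a single isometry splits H into the reducing
   subspaces U_i = \bigcap_k V_i^k H and S_i = U_i^perp.  By double
   commutativity all U_i and S_i reduce every V_j, and a subspace X reducing
   V_i is the sum of X & U_i and X & S_i; hence the subspaces
   H_A = \bigcap_(i in A) S_i & \bigcap_(i notin A) U_i decompose H.
   A reducing subspace X of S_i is spanned by the V_i^k (X & ker V_i^* ): a
   vector q of X orthogonal to all of them satisfies q = V_i^k (V_i^* )^k q for
   all k, so it lies in U_i.  Iterating this over i in A gives the formula for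
   H_A.  For uniqueness, the A-component of any decomposition is contained in
   H_A, and two orthogonal decompositions with componentwise inclusions
   coincide. *)
Require Import Defs.
From HB Require Import structures.
From mathcomp Require Import all_boot all_order all_algebra.
From mathcomp Require Import ring.
From mathcomp Require Import complex.
From mathcomp Require Import mathcomp_extra boolp classical_sets functions.
From mathcomp Require Import reals topology normedtype.

Set Implicit Arguments.
Unset Strict Implicit.
Unset Printing Implicit Defensive.

Import Order.TTheory GRing.Theory Num.Theory.
Import numFieldNormedType.Exports.

Local Open Scope classical_set_scope.
Local Open Scope ring_scope.

(** * Inner product identities, Cauchy-Schwarz and polarization *)

Section InnerProduct.
Variables (R : realType) (H : hilbertType R).
Implicit Types (x y z : H) (a : R[i]).

Lemma innerDl x y z : inner (x + y) z = inner x z + inner y z.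
Proof. exact: linearDl. Qed.
Lemma innerDr x y z : inner z (x + y) = inner z x + inner z y.
Proof. exact: linearDr. Qed.
Lemma innerBl x y z : inner (x - y) z = inner x z - inner y z.
Proof. exact: linearBl. Qed.
Lemma innerBr x y z : inner z (x - y) = inner z x - inner z y.
Proof. exact: linearBr. Qed.
Lemma innerZl a x z : inner (a *: x) z = a * inner x z.
Proof. exact: linearZl_LR. Qed.
Lemma innerZr a x z : inner z (a *: x) = a^* * inner z x.
Proof. exact: linearZr_LR. Qed.
Lemma inner0l z : inner 0 z = 0 :> R[i].
Proof. exact: linear0l. Qed.
Lemma inner0r z : inner z 0 = 0 :> R[i].
Proof. exact: linear0r. Qed.
Lemma innerC x y : inner y x = (inner x y)^*.
Proof. by rewrite (hermC inner y x) expr0 mul1r. Qed.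

Lemma inner_eq0 x : inner x x = 0 -> x = 0.
Proof. by rewrite -inner_normE => /eqP; rewrite expf_eq0 normr_eq0 => /eqP. Qed.

Lemma inner_eq0C x y : inner x y = 0 -> inner y x = 0.
Proof. by move=> xy; rewrite innerC xy conjC0. Qed.

Lemma sqrnormD x y :
  `|x + y| ^+ 2 = `|x| ^+ 2 + `|y| ^+ 2 + (inner x y + (inner x y)^*).
Proof. by rewrite !inner_normE innerDl !innerDr (innerC x y); ring. Qed.

Lemma parallelogram x y :
  `|x - y| ^+ 2 + `|x + y| ^+ 2 = 2 * (`|x| ^+ 2 + `|y| ^+ 2).
Proof.
by rewrite !inner_normE innerBl innerDl !innerBr !innerDr; ring.
Qed.

(** Pythagoras for the residual of x after projection onto the line of y, multiplied by |y|^2 so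
    that y = 0 is covered. Nonnegativity of the left side is Cauchy-Schwarz. *)
Lemma sqrnorm_proj x y :
  `|x - (inner x y / `|y| ^+ 2) *: y| ^+ 2 * `|y| ^+ 2
  = `|x| ^+ 2 * `|y| ^+ 2 - `|inner x y| ^+ 2.
Proof.
have [->|y0] := eqVneq y 0.
  by rewrite normr0 inner0r normr0 expr0n /= !mulr0 subr0.
have y20 : `|y| ^+ 2 != 0 by rewrite expf_eq0 normr_eq0.
rewrite normCK [in LHS]inner_normE innerBl !innerBr !innerZl !innerZr.
rewrite (innerC x y).
rewrite rmorphM fmorphV /= -!inner_normE.
have -> : (`|y| ^+ 2)^* = `|y| ^+ 2 by rewrite geC0_conj ?exprn_ge0.
move: (`|y| ^+ 2) y20 (`|x| ^+ 2) (inner x y) => b b0 a c.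
rewrite mulfVK// subrr subr0 mulrBl; congr (_ - _).
by rewrite mulrAC divfK// mulrC.
Qed.

Lemma norm_inner_le x y : `|inner x y| <= `|x| * `|y|.
Proof.
rewrite -ler_sqr ?nnegrE ?mulr_ge0// exprMn -subr_ge0 -sqrnorm_proj.
by rewrite mulr_ge0 ?exprn_ge0.
Qed.

(** Polarization: the norms of [a *: x + y] determine the real part of [a * inner x y]; a = 1 and a
    = i recover the whole inner product. *)
Lemma inner_isometry (T : H -> H) (X : set H) :
    linear T -> submod_closed (mem X) -> (forall x, X x -> `|T x| = `|x|) ->
  forall x y, X x -> X y -> inner (T x) (T y) = inner x y.
Proof.
move=> linT [_ linX] isoT x y Xx Xy.
have re a : (a * inner (T x) (T y)) + (a * inner (T x) (T y))^*
          = (a * inner x y) + (a * inner x y)^*.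
  have XD : X (a *: x + y).
    by have := linX a x y; rewrite !inE => /(_ Xx Xy).
  have : `|T (a *: x + y)| ^+ 2 = `|a *: x + y| ^+ 2 by rewrite isoT.
  rewrite linT !sqrnormD !normrZ !isoT// !innerZl => /addrI; exact.
have := re 1; have := re 'i; rewrite !mul1r !rmorphM/= conjCi.
set u := inner (T x) (T y); set v := inner x y => e1 e2.
have i0 : 'i != 0 :> R[i] by exact: neq0Ci.
have e3 : u - u^* = v - v^*.
  apply: (mulfI i0); move: e1; rewrite !mulrBr !mulNr; exact.
move: (u^*) (v^*) e2 e3 => u' v' e2 e3.
have uu : u + u = v + v.
  have := congr1 (+%R^~ (u - u')) e2; rewrite [in RHS]e3 !addrA.
  by rewrite (addrAC u u') (addrAC v v') !addrK.
by apply: (@mulIf _ 2); rewrite ?pnatr_eq0// !mulr_natr !mulr2n.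
Qed.

End InnerProduct.

(** The arithmetic of the Cauchy estimate below: two squared distances below d + (e/2)^2 turn the
    parallelogram identity into the bound e^2 + 4d. *)
Lemma quarter_sum (F : numFieldType) (d e : F) :
  2 * (d + (e / 2) ^+ 2 + (d + (e / 2) ^+ 2)) = e ^+ 2 + 4 * d.
Proof. by field. Qed.

(** * Closed subspaces, closed spans and the least squares problem *)

Section ClosedSubspaces.
Variables (R : realType) (H : hilbertType R).
Implicit Types (x y z : H) (a : R[i]) (X Y : set H) (T : H -> H).

Lemma linB T : linear T -> {morph T : x y / x - y}.
Proof. by move=> linT x y; rewrite addrC -scaleN1r linT scaleN1r addrC. Qed.

Lemma lin0 T : linear T -> T 0 = 0.
Proof. by move=> linT; have := linB linT 0 0; rewrite !subrr. Qed.

Lemma linD T : linear T -> {morph T : x y / x + y}.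
Proof. by move=> linT x y; rewrite -[x]scale1r linT !scale1r. Qed.

Lemma linZ T a : linear T -> {morph T : x / a *: x}.
Proof. by move=> linT x; rewrite -[_ *: x]addr0 linT lin0// addr0. Qed.

Lemma closed_subspaceP X : closed_subspace X <->
  [/\ X 0, forall a x y, X x -> X y -> X (a *: x + y)
    & forall x, (forall e : R[i], 0 < e -> exists2 y, X y & `|x - y| < e) ->
        X x].
Proof.
split=> [[[X0 XP] clX]|[X0 XP clX]]; split.
- by move: X0; rewrite inE.
- by move=> a x y Xx Xy; have := XP a x y; rewrite !inE; apply.
- move=> x Hx; apply: clX => B /nbhs_ballP [e e0 xB].
  have [y Xy xy] := Hx _ e0; exists y; split=> //; apply: xB.
  by rewrite -ball_normE.
- split; first by rewrite inE.
  by move=> a x y; rewrite !inE; apply: XP.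
- move=> x clXx; apply: clX => e e0.
  have [y [Xy]] := clXx _ (nbhsx_ballx x e e0).
  by rewrite -ball_normE; exists y.
Qed.

Section Closure.
Variables (X : set H) (clX : closed_subspace X).

Lemma csub0 : X 0.
Proof. by have /closed_subspaceP [] := clX. Qed.

Lemma csubP a x y : X x -> X y -> X (a *: x + y).
Proof. by have /closed_subspaceP [_ + _] := clX; apply. Qed.

Lemma csubZ a x : X x -> X (a *: x).
Proof. by move=> Xx; rewrite -[_ *: _]addr0; apply: csubP => //; exact: csub0.
Qed.

Lemma csubD x y : X x -> X y -> X (x + y).
Proof. by move=> Xx; rewrite -[x]scale1r; apply: csubP. Qed.

Lemma csubB x y : X x -> X y -> X (x - y).
Proof. by move=> Xx Xy; rewrite addrC -scaleN1r; apply: csubP. Qed.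

End Closure.

Lemma closed_subspace_setT : closed_subspace [set: H].
Proof. exact/closed_subspaceP. Qed.

Lemma closed_subspace_bigcap (I : Type) (D : set I) (F : I -> set H) :
  (forall i, D i -> closed_subspace (F i)) ->
  closed_subspace (\bigcap_(i in D) F i).
Proof.
move=> clF; apply/closed_subspaceP; split.
- by move=> i /clF /csub0.
- by move=> a x y Fx Fy i Di; apply: csubP; [exact: clF | exact: Fx | exact: Fy].
- move=> x Hx i Di; have /closed_subspaceP [_ _] := clF i Di; apply => e e0.
  by have [y Fy xy] := Hx _ e0; exists y => //; apply: Fy.
Qed.

Lemma closed_subspaceI X Y :
  closed_subspace X -> closed_subspace Y -> closed_subspace (X `&` Y).
Proof.
by move=> clX clY; rewrite -bigcap2inE; apply: closed_subspace_bigcap => -[|[|]].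
Qed.

Lemma closed_subspace_preimage T X : linear T -> (forall x, `|T x| <= `|x|) ->
  closed_subspace X -> closed_subspace (T @^-1` X).
Proof.
move=> linT leT clX; apply/closed_subspaceP; split => /=.
- by rewrite lin0//; exact: csub0.
- by move=> a x y Xx Xy; rewrite linT; apply: csubP.
- move=> x Hx; have /closed_subspaceP [_ _] := clX; apply=> e e0.
  have [y Xy xy] := Hx _ e0; exists (T y) => //.
  rewrite -(linB linT); exact: le_lt_trans xy.
Qed.

Lemma closed_span_closed X : closed_subspace (closed_span X).
Proof.
apply: (@closed_subspace_bigcap _ [set M | closed_subspace M /\ X `<=` M] id).
by move=> M [].
Qed.

Lemma sub_closed_span X : X `<=` closed_span X.
Proof. exact: sub_gen_smallest. Qed.

Lemma closed_span_sub X Y :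
  closed_subspace Y -> X `<=` Y -> closed_span X `<=` Y.
Proof. exact: smallest_sub. Qed.

Definition orthocomplement X : set H :=
  [set x | forall y, X y -> inner x y = 0].

Lemma closed_orthocomplement X : closed_subspace (orthocomplement X).
Proof.
apply/closed_subspaceP; split => /=.
- by move=> y _; rewrite inner0l.
- by move=> a x y Hx Hy z Xz; rewrite innerDl innerZl Hx// Hy// mulr0 addr0.
- move=> x Hx z Xz; apply: contrapT => /eqP nz.
  have c0 : 0 < `|inner x z| by rewrite normr_gt0.
  have z0 : 0 < `|z|.
    by rewrite normr_gt0; apply: contra_neq nz => ->; rewrite inner0r.
  have [y Xy xy] := Hx _ (divr_gt0 c0 z0).
  have : `|inner x z| <= `|x - y| * `|z|.
    by have := norm_inner_le (x - y) z; rewrite innerBl Xy// subr0.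
  by rewrite -ler_pdivrMr// => /(lt_le_trans xy); rewrite ltxx.
Qed.

Lemma orthocomplement_disj X x : X x -> orthocomplement X x -> x = 0.
Proof. by move=> Xx; move=> /(_ _ Xx); apply: inner_eq0. Qed.

(* The near-minimizers of the distance from y to T X form a Cauchy filter by the
   parallelogram identity. *)
Lemma least_squares T X y : linear T -> (forall x, `|T x| = `|x|) ->
    closed_subspace X ->
  exists2 z, X z & forall x, X x -> inner (y - T z) (T x) = 0.
Proof.
move=> linT isoT clX.
(* The infimum is taken in R, so the squared norm, a value in R[i], is replaced by its real part. *)
pose dist2 z := complex.Re (`|y - T z| ^+ 2).
have dist2E z : (dist2 z)%:C%C = `|y - T z| ^+ 2.
  by apply: RRe_real; rewrite ger0_real// exprn_ge0.
pose E := [set dist2 z | z in X].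
have E0 : has_inf E.
  split; first by exists (dist2 0), 0 => //; exact: csub0.
  by exists 0 => _ [z _ <-]; rewrite -lecR dist2E exprn_ge0.
pose d := (inf E)%:C%C.
have d_le z : X z -> d <= `|y - T z| ^+ 2.
  by move=> Xz; rewrite -dist2E lecR; apply: ge_inf; [case: E0 | exists z].
pose near_min (e : R[i]) := [set z | X z /\ `|y - T z| ^+ 2 < d + e ^+ 2].
pose F := filter_from [set e : R[i] | 0 < e] near_min.
have near_min0 e : 0 < e -> near_min e !=set0.
  move=> e0; have e20 : 0 < e ^+ 2 by rewrite exprn_gt0.
  have eE : (complex.Re (e ^+ 2))%:C%C = e ^+ 2 by apply/RRe_real/gtr0_real.
  have [|_ [z Xz <-] Hz] := @inf_adherent _ E (complex.Re (e ^+ 2)) _ E0.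
    by rewrite -ltcR eE.
  exists z; split=> //; rewrite -dist2E -eE.
  by move: Hz; rewrite -ltcR rmorphD.
have FF : ProperFilter F.
  apply: filter_from_proper near_min0.
  apply: filter_from_filter; first by exists 1 => /=.
  move=> e1 e2 /= e10 e20.
  have [le12|le21] : e1 <= e2 \/ e2 <= e1.
    by apply/orP; apply: real_leVge; exact: gtr0_real.
    exists e1 => // z [Xz zd]; split=> //; split=> //.
    by apply: (lt_le_trans zd); rewrite lerD2l ler_sqr ?nnegrE// ltW.
  exists e2 => // z [Xz zd]; split=> //; split=> //.
  by apply: (lt_le_trans zd); rewrite lerD2l ler_sqr ?nnegrE// ltW.
have Fcauchy : cauchy F.
  apply/cauchy_ballP => e e0.
  exists (near_min (e / 2), near_min (e / 2)) => /=.
    by split; exists (e / 2) => //=; rewrite divr_gt0.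
  move=> [u v] /= [[Xu ud] [Xv vd]]; rewrite -ball_normE /ball_ /=.
  rewrite -isoT (linB linT) -ltr_sqr ?nnegrE ?normr_ge0 ?(ltW e0)//.
  have -> : T u - T v = (y - T v) - (y - T u).
    by rewrite opprB [RHS]addrC subrKA.
  (* The midpoint of two near-minimizers lies in X, so its squared distance to y is at least d; the
     parallelogram identity then bounds |T u - T v|^2 by e^2. *)
  have mid : d <= `|y - T (2^-1 *: (u + v))| ^+ 2.
    by apply: d_le; apply: csubZ => //; apply: csubD.
  have midE : `|(y - T v) + (y - T u)| ^+ 2
            = 4 * `|y - T (2^-1 *: (u + v))| ^+ 2.
    have -> : (y - T v) + (y - T u) = 2 *: (y - T (2^-1 *: (u + v))).
      rewrite scalerBr -(linZ _ linT) scalerA divff ?pnatr_eq0// scale1r.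
      rewrite (linD linT).
      by rewrite scaler_nat mulr2n addrACA opprD [- T v - _]addrC.
    by rewrite normrZ exprMn normr_nat -natrX.
  rewrite -(ltrD2r (`|(y - T v) + (y - T u)| ^+ 2)) parallelogram midE.
  have lt_sum2 : 2 * (`|y - T v| ^+ 2 + `|y - T u| ^+ 2) < e ^+ 2 + 4 * d.
    by rewrite -quarter_sum ltr_pM2l ?ltr0n//; apply: ltrD.
  by apply: (lt_le_trans lt_sum2); rewrite lerD2l ler_pM2l ?ltr0n.
have [z Fz] := (cvg_ex F).1 ((cauchy_cvgP F).1 Fcauchy).
(* The sets [near_min] are nested, so the smaller of e and e' yields a point that is both
   near-minimal and close to the limit z. *)
have close e : 0 < e -> exists2 u, near_min e u & `|z - u| < e.
  move=> e0; have [e' /= e'0 He'] := Fz _ (nbhsx_ballx z e e0).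
  have [le|le] : e <= e' \/ e' <= e.
    by apply/orP; apply: real_leVge; exact: gtr0_real.
    have [u uP] := near_min0 _ e0; exists u => //.
    have : ball z e u.
      apply: He'; case: uP => Xu ud; split=> //; apply: (lt_le_trans ud).
      by rewrite lerD2l ler_sqr ?nnegrE// ltW.
    by rewrite -ball_normE.
  have [u uP] := near_min0 _ e'0; exists u.
    case: uP => Xu ud; split=> //; apply: (lt_le_trans ud).
    by rewrite lerD2l ler_sqr ?nnegrE// ltW.
  by have := He' _ uP; rewrite -ball_normE.
exists z.
  have /closed_subspaceP [_ _] := clX; apply=> e e0.
  by have [u [Xu _] zu] := close e e0; exists u.
move=> x Xx; apply: contrapT => /eqP nz.
have c0 : 0 < `|inner (y - T z) (T x)| by rewrite normr_gt0.
have x0 : 0 < `|x|.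
  by rewrite normr_gt0; apply: contra_neq nz => ->; rewrite lin0// inner0r.
(* With this e, the residual at a nearby near-minimizer u contributes less than e |x| and the
   displacement T (u - z) at most e |x|, while the inner product equals their total 2 e |x|. *)
pose e := `|inner (y - T z) (T x)| / (2 * `|x|).
have e0 : 0 < e by rewrite divr_gt0// mulr_gt0.
have eE : e * `|x| + e * `|x| = `|inner (y - T z) (T x)|.
  rewrite -mulrDl -mulr2n -mulr_natr -mulrA /e mulfVK//.
  by rewrite gt_eqF// mulr_gt0.
clearbody e; have [u [Xu ud] zu] := close e e0.
(* Subtracting the best multiple t T x gives the residual of u + t x, of squared norm at least d. As
   u is near-minimal, the decrease |inner|^2 / |x|^2 is below e^2. *)
have lt1 : `|inner (y - T u) (T x)| < e * `|x|.
  rewrite -ltr_sqr ?nnegrE ?mulr_ge0 ?normr_ge0 ?(ltW e0)//.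
  rewrite exprMn.
  pose t := inner (y - T u) (T x) / `|T x| ^+ 2.
  have : (d + e ^+ 2) * `|x| ^+ 2 > `|y - T u| ^+ 2 * `|x| ^+ 2.
    by rewrite ltr_pM2r ?exprn_gt0.
  have := sqrnorm_proj (y - T u) (T x); rewrite -/t isoT => tE.
  have : d * `|x| ^+ 2 <= `|y - T u - t *: T x| ^+ 2 * `|x| ^+ 2.
    rewrite ler_pM2r ?exprn_gt0// -(linZ _ linT) -addrA -opprD -(linD linT).
    by apply: d_le; apply: csubD => //; apply: csubZ.
  rewrite tE lerBrDr mulrDl => le1 lt1.
  by have := le_lt_trans le1 lt1; rewrite ltrD2l.
have lt2 : `|inner (T (u - z)) (T x)| <= e * `|x|.
  apply: (le_trans (norm_inner_le _ _)); rewrite !isoT ler_pM2r// distrC.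
  exact: ltW.
have : `|inner (y - T z) (T x)| < e * `|x| + e * `|x|.
  have -> : y - T z = (y - T u) + T (u - z) by rewrite (linB linT) subrKA.
  by rewrite innerDl; apply: (le_lt_trans (ler_normD _ _)); apply: ltr_leD.
by rewrite eE ltxx.
Qed.

End ClosedSubspaces.

(** * Orthogonal projections and linear isometries *)

Section Isometries.
Variables (R : realType) (H : hilbertType R).
Implicit Types (x y z : H) (a : R[i]) (X Y M : set H) (S T : H -> H).

Lemma orthogonal_decomposition X x : closed_subspace X ->
  exists p q, [/\ X p, orthocomplement X q & x = p + q].
Proof.
move=> clX; have linid : linear (@id H) by [].
have [p Xp pP] := @least_squares _ H id X x linid (fun=> erefl) clX.
by exists p, (x - p); split=> //; rewrite addrC subrK.
Qed.

Lemma inner_extr y z : (forall x, inner x y = inner x z) -> y = z.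
Proof.
move=> yz; apply/eqP; rewrite -subr_eq0; apply/eqP/inner_eq0.
by rewrite innerBr yz subrr.
Qed.

Definition linear_isometry T := linear T /\ forall x, `|T x| = `|x|.

Lemma linear_isometry_inner T x y :
  linear_isometry T -> inner (T x) (T y) = inner x y.
Proof.
move=> [linT isoT]; apply: (@inner_isometry _ _ T setT) => //.
by have [] := @closed_subspace_setT R H.
Qed.

Lemma linear_isometry_iter T k :
  linear_isometry T -> linear_isometry (iter k T).
Proof.
move=> [linT isoT]; split; elim: k => [|k IHk] //=.
  by move=> a x y /=; rewrite IHk linT.
by move=> x; rewrite isoT.
Qed.

(** * The adjoint of an isometry *)

Section Adjoint.
Variables (T : H -> H) (isoT : linear_isometry T).

(** Least squares over the whole space gives z with y - T z orthogonal to the range of T, so <T x,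
    y> = <T x, T z> = <x, z>. Hence [xget] in [adjoint] finds a value and never returns its
    default. *)
Lemma adjointP x y : inner (T x) y = inner x (adjoint T y).
Proof.
have [z _ zP] := least_squares y isoT.1 isoT.2 (closed_subspace_setT H).
rewrite /adjoint; case: xgetP => [_ _ /(_ x) //|/(_ z)[]] /= {}x.
apply/eqP; rewrite -(linear_isometry_inner x z isoT) -subr_eq0 -innerBr.
by apply/eqP/inner_eq0C/zP.
Qed.

Lemma adjointPl x y : inner (adjoint T x) y = inner x (T y).
Proof. by rewrite innerC -adjointP -innerC. Qed.

Lemma adjointK : cancel T (adjoint T).
Proof.
move=> x; apply: inner_extr => y.
by rewrite -adjointP linear_isometry_inner.
Qed.

Lemma adjoint_linear : linear (adjoint T).
Proof.
move=> a x y; apply: inner_extr => z.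
by rewrite -adjointP !innerDr !innerZr !adjointP.
Qed.

Lemma adjoint_contraction x : `|adjoint T x| <= `|x|.
Proof.
have [->|nz] := eqVneq (adjoint T x) 0; first by rewrite normr0.
have := norm_inner_le (T (adjoint T x)) x.
rewrite adjointP -inner_normE normrX normr_id isoT.2 expr2 ler_pM2l//.
by rewrite normr_gt0.
Qed.

Lemma closed_ker_adjoint : closed_subspace [set x | adjoint T x = 0].
Proof.
have -> : [set x | adjoint T x = 0] = orthocomplement (range T).
  rewrite eqEsubset; split=> x /=.
    by move=> x0 _ [y _ <-]; rewrite -adjointPl x0 inner0l.
  move=> xT; apply: inner_extr => y.
  by rewrite inner0r; apply: inner_eq0C; rewrite adjointPl; apply: xT; exists y.
exact: closed_orthocomplement.
Qed.

Lemma adjoint_defect x : adjoint T (x - T (adjoint T x)) = 0.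
Proof. by rewrite (linB adjoint_linear) adjointK subrr. Qed.

(** The image is the preimage of X under [adjoint T], cut down to the orthogonal complement of the
    kernel of [adjoint T]; both sets are closed subspaces. *)
Lemma closed_isometry_image X : closed_subspace X -> closed_subspace (T @` X).
Proof.
move=> clX.
have -> : T @` X = (adjoint T @^-1` X) `&`
    orthocomplement [set x | adjoint T x = 0].
  rewrite eqEsubset; split=> [_ [x Xx <-]|x [/= Xx xker]].
    split; first by rewrite /= adjointK.
    by move=> y /= y0; rewrite adjointP y0 inner0r.
  exists (adjoint T x) => //; apply/eqP; rewrite -subr_eq0 -oppr_eq0 opprB.
  have e0 := adjoint_defect x; apply/eqP/inner_eq0.
  by rewrite {1}innerBl xker// adjointP e0 inner0r subrr.
apply: closed_subspaceI; last exact: closed_orthocomplement.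
exact: closed_subspace_preimage adjoint_linear adjoint_contraction clX.
Qed.

End Adjoint.

(** * Reducing subspaces and the Wold decomposition of one isometry *)

Section Reducing.
Variables (T : H -> H) (isoT : linear_isometry T).

Lemma reducingP X : reducing T X <->
  [/\ closed_subspace X, forall x, X x -> X (T x)
    & forall x, X x -> X (adjoint T x)].
Proof.
split=> -[clX TX aX]; split=> //.
- by move=> x Xx; apply: TX; exists x.
- by move=> x Xx; apply: aX; exists x.
- by move=> _ [x Xx <-]; apply: TX.
- by move=> _ [x Xx <-]; apply: aX.
Qed.

Lemma reducing_orthocomplement X :
  reducing T X -> reducing T (orthocomplement X).
Proof.
move=> /reducingP [clX TX aX]; apply/reducingP; split.
- exact: closed_orthocomplement.
- by move=> x Hx y Xy; rewrite adjointP//; apply/Hx/aX.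
- by move=> x Hx y Xy; rewrite adjointPl//; apply/Hx/TX.
Qed.

Lemma reducing_bigcap (I : Type) (F : I -> set H) :
  (forall i, reducing T (F i)) -> reducing T (\bigcap_i F i).
Proof.
move=> redF; apply/reducingP; split.
- by apply: closed_subspace_bigcap => i _; have /reducingP [] := redF i.
- by move=> x Fx i _; have /reducingP [_ + _] := redF i; apply; apply: Fx.
- by move=> x Fx i _; have /reducingP [_ _] := redF i; apply; apply: Fx.
Qed.

Lemma reducingI X Y : reducing T X -> reducing T Y -> reducing T (X `&` Y).
Proof.
move=> redX redY; rewrite -bigcap2E; apply: reducing_bigcap => -[|[|]] //=.
by move=> _; split=> //; exact: closed_subspace_setT.
Qed.

Definition unit_part T : set H := \bigcap_k range (iter k T).
Definition shift_part T : set H := orthocomplement (unit_part T).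

Lemma closed_unit_part : closed_subspace (unit_part T).
Proof.
apply: closed_subspace_bigcap => k _; apply: closed_isometry_image.
  exact: linear_isometry_iter.
exact: closed_subspace_setT.
Qed.

Lemma unit_partK x : unit_part T x -> T (adjoint T x) = x.
Proof. by move=> /(_ 1%N I) [y _ /= <-]; rewrite adjointK. Qed.

Lemma reducing_unit_part : reducing T (unit_part T).
Proof.
apply/reducingP; split; first exact: closed_unit_part.
  by move=> x Ux k _; have [y _ <-] := Ux k I; exists (T y); rewrite // -iterSr.
move=> x Ux k _; have [y _ <-] := Ux k.+1 I.
by exists y; rewrite // iterS adjointK.
Qed.

Lemma reducing_shift_part : reducing T (shift_part T).
Proof. exact/reducing_orthocomplement/reducing_unit_part. Qed.

Lemma ker_adjoint_shift_part x : adjoint T x = 0 -> shift_part T x.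
Proof.
move=> x0 _ /(_ 1%N I) [y _ /= <-]; apply: inner_eq0C.
by rewrite adjointP// x0 inner0r.
Qed.

Lemma sub_unit_part X : (forall x, X x -> X (adjoint T x)) ->
  (forall x, X x -> T (adjoint T x) = x) -> X `<=` unit_part T.
Proof.
move=> aX XK x Xx k _; elim: k x Xx => [|k IHk] x Xx /=; first by exists x.
have [y _ yE] := IHk _ (aX _ Xx); exists y => //.
by rewrite /= yE XK.
Qed.

(** Projecting x onto X and the unitary part together leaves a remainder orthogonal to that
    intersection only. It is orthogonal to all of [unit_part T] because the X-component of a vector
    of [unit_part T] is again in [unit_part T]. *)
Lemma reducing_wold X x : reducing T X -> X x ->
  exists u s, [/\ X u, unit_part T u, X s, shift_part T s & x = u + s].
Proof.
move=> /[dup] redX /reducingP [clX TX aX] Xx.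
have [u [s [[Xu Uu] sP xE]]] :=
  orthogonal_decomposition x (closed_subspaceI clX closed_unit_part).
have Xs : X s.
  by have -> : s = x - u; [rewrite xE addrC addKr | exact: csubB].
exists u, s; split=> // v Uv.
have [b [c [Xb Xc vE]]] := orthogonal_decomposition v clX.
rewrite vE innerDr (inner_eq0C (Xc _ Xs)) addr0; apply: sP; split=> // k _.
have [w _ wE] := Uv k I.
(* Splitting along X commutes with T^k, as X and its complement are invariant: b and T^k b' differ
   by a vector lying in both, hence agree. *)
have [b' [c' [Xb' Xc' wE']]] := orthogonal_decomposition w clX.
have [linTk isoTk] := linear_isometry_iter k isoT.
have Tb : X (iter k T b') by elim: (k) => //= j; exact: TX.
have Tc : orthocomplement X (iter k T c').
  have /reducingP [_ TXc _] := reducing_orthocomplement redX.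
  by elim: (k) => //= j; exact: TXc.
exists b' => //; apply/eqP; rewrite -subr_eq0; apply/eqP.
apply: (orthocomplement_disj (X := X)); first exact: csubB.
have -> : iter k T b' - b = c - iter k T c'.
  apply/eqP; rewrite subr_eq addrAC eq_sym subr_eq [c + _]addrC -vE -wE wE'.
  by rewrite (linD linTk).
exact: (csubB (@closed_orthocomplement _ _ X)).
Qed.

Lemma shift_part_span X M : reducing T X -> X `<=` shift_part T ->
    closed_subspace M ->
    (forall k w, X w -> adjoint T w = 0 -> M (iter k T w)) ->
  X `<=` M.
Proof.
move=> /reducingP [clX TX aX] XS clM MW x Xx.
have [p [q [[Xp Mp] qP xE]]] :=
  orthogonal_decomposition x (closed_subspaceI clX clM).
have Xq : X q.
  by have -> : q = x - p; [rewrite xE addrC addKr | exact: csubB].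
suff Uq : unit_part T q by rewrite xE (orthocomplement_disj Uq (XS _ Xq)) addr0.
have TXk k y : X y -> X (iter k T y) by move=> Xy; elim: k => //= k; exact: TX.
have aXk k : X (iter k (adjoint T) q) by elim: k => //= k; exact: aX.
move=> k _; suff qE : iter k T (iter k (adjoint T) q) = q.
  by exists (iter k (adjoint T) q).
elim: k => [|k IHk] //; rewrite iterSr -[RHS]IHk iterS; congr (iter k T _).
set z := iter k _ q in IHk *; have Xz : X z by exact: aXk.
(* The defect e lies in X and in the kernel of [adjoint T], so T^k e is in M and orthogonal to q =
   T^k z. Cancelling T^k gives <z, e> = 0, and <z, e> is |e|^2. *)
pose e := z - T (adjoint T z); have e0 : adjoint T e = 0 by exact: adjoint_defect.
have Xe : X e by apply: csubB => //; exact/TX/aX.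
apply/eqP; rewrite eq_sym -subr_eq0 -/e; apply/eqP/inner_eq0.
rewrite {1}/e innerBl adjointP// e0 inner0r subr0.
rewrite -(linear_isometry_inner z e (linear_isometry_iter k isoT)) IHk.
by apply: qP; split; [exact: TXk | exact: MW].
Qed.

(** Cancelling the common power leaves a vector of the kernel of [adjoint T] against one of the
    range of T. *)
Lemma iter_ker_adjoint_orthogonal k l x y :
    adjoint T x = 0 -> adjoint T y = 0 -> k <> l ->
  inner (iter k T x) (iter l T y) = 0.
Proof.
wlog kl : k l x y / (k < l)%N.
  move=> Hw x0 y0 kl; have [|lk|//] := ltngtP k l; first by move=> ?; exact: Hw.
  by apply: inner_eq0C; apply: Hw => // lkE; apply: kl.
move=> x0 _ _; rewrite -(subnKC kl) addSn -addnS iterD.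
rewrite (linear_isometry_inner _ _ (linear_isometry_iter k isoT)).
by rewrite iterS -adjointPl// x0 inner0l.
Qed.

End Reducing.

End Isometries.

(** * Doubly commuting families and their joint powers *)

Section DoublyCommuting.
Variables (R : realType) (H : hilbertType R) (J : eqType) (V : J -> H -> H).
Implicit Types (x y z : H) (X M W : set H) (i j : J) (s : seq J) (k : J -> nat).

(** An arbitrary index type and a symmetric condition i != j let subtuples indexed by
    [{i | i \in A}] be treated without renumbering. *)
Definition doubly_commuting_family :=
  [/\ forall i, linear_isometry (V i),
      forall i j x, V i (V j x) = V j (V i x)
    & forall i j, i != j ->
        forall x, V i (adjoint (V j) x) = adjoint (V j) (V i x)].

Hypothesis dcV : doubly_commuting_family.

Lemma dc_isometry i : linear_isometry (V i).
Proof. by case: dcV. Qed.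
Let isoV := dc_isometry.

Lemma adjoint_comm i j x :
  adjoint (V i) (adjoint (V j) x) = adjoint (V j) (adjoint (V i) x).
Proof.
case: dcV => _ VC _; apply: inner_extr => y.
by rewrite -!adjointP// VC.
Qed.

Lemma iter_comm i j a b x :
  iter a (V i) (iter b (V j) x) = iter b (V j) (iter a (V i) x).
Proof.
case: dcV => _ VC _.
have VCb y : V i (iter b (V j) y) = iter b (V j) (V i y).
  by elim: b => //= b IHb; rewrite VC IHb.
by elim: a => //= a IHa; rewrite IHa VCb.
Qed.

(** For i != j both V_i and its adjoint commute with V_j, hence preserve the range of every power of
    V_j. *)
Lemma reducing_unit_partF i j : reducing (V i) (unit_part (V j)).
Proof.
have [<-|ij] := eqVneq i j; first exact: reducing_unit_part.
case: dcV => _ _ aVC.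
apply/reducingP; split; first exact: closed_unit_part.
  move=> x Ux a _; have [y _ <-] := Ux a I; exists (V i y) => //.
  exact: (iter_comm j i a 1).
move=> x Ux a _; have [y _ <-] := Ux a I; exists (adjoint (V i) y) => //.
by elim: a {Ux} => //= a IHa; rewrite IHa aVC// eq_sym.
Qed.

Lemma reducing_shift_partF i j : reducing (V i) (shift_part (V j)).
Proof. exact/reducing_orthocomplement/reducing_unit_partF. Qed.

Lemma reducing_ker_adjoint i j :
  i != j -> reducing (V i) [set x | adjoint (V j) x = 0].
Proof.
move=> ij; case: dcV => _ _ aVC.
apply/reducingP; split => [|x /= x0|x /= x0]; first exact: closed_ker_adjoint.
  by rewrite -aVC// x0 lin0//; case: (isoV i).
by rewrite adjoint_comm x0 lin0//; exact: adjoint_linear.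
Qed.

Definition wold_part (b : bool) i : set H :=
  if b then shift_part (V i) else unit_part (V i).

Lemma reducing_wold_part b i j : reducing (V i) (wold_part b j).
Proof.
by case: b; [exact: reducing_shift_partF | exact: reducing_unit_partF].
Qed.

(** Induction on s splits X along one V_i at a time; each piece still reduces the whole family, and
    b records the choices made. *)
Lemma wold_parts_span s X M : (forall i, reducing (V i) X) -> closed_subspace M ->
    (forall b : J -> bool,
       X `&` [set x | forall i, i \in s -> wold_part (b i) i x] `<=` M) ->
  X `<=` M.
Proof.
move=> + clM; elim: s X => [|i s IHs] X redX XM x Xx.
  by apply: (XM xpredT); split.
have [u [v [Xu Uu Xv Sv ->]]] := reducing_wold (isoV i) (redX i) Xx.
suff in_M c y : X y -> wold_part c i y -> M y.
  by apply: csubD => //; [exact: (in_M false) | exact: (in_M true)].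
move=> Xy cy; apply: (IHs (X `&` wold_part c i)) => // [j|b z [[Xz cz] bz]].
  by apply: reducingI => //; exact: reducing_wold_part.
apply: (XM (fun j => if j == i then c else b j)); split=> // j.
rewrite inE; case: eqVneq => [->|_ /=] //; exact: bz.
Qed.

Definition mpow s k : H -> H := \big[comp/id]_(i <- s) iter (k i) (V i).

Lemma mpow_nil k : mpow [::] k = id.
Proof. by rewrite /mpow big_nil. Qed.

Lemma mpow_cons i s k x : mpow (i :: s) k x = iter (k i) (V i) (mpow s k x).
Proof. by rewrite /mpow big_cons. Qed.

Lemma linear_isometry_mpow s k : linear_isometry (mpow s k).
Proof.
elim: s => [|i s [linT isoT]]; first by rewrite mpow_nil.
have [linV isoVk] := linear_isometry_iter (k i) (isoV i).
split=> [a x y|x]; rewrite !mpow_cons; first by rewrite linT linV.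
by rewrite isoVk isoT.
Qed.

Lemma mpow_closed s k W x :
  (forall i y, i \in s -> W y -> W (V i y)) -> W x -> W (mpow s k x).
Proof.
move=> VW Wx; elim: s VW => [|i s IHs] VW; first by rewrite mpow_nil.
rewrite mpow_cons; have : W (mpow s k x).
  by apply: IHs => j y js; apply: VW; rewrite inE js orbT.
elim: (k i) => //= a IHa Wy; apply: VW; rewrite ?mem_head//; exact: IHa.
Qed.

(** The power of V_i is commuted to the front. W is a property of x preserved by the other
    isometries, for instance membership in the kernel of [adjoint (V i)]. *)
Lemma mpow_factor i s k W x : uniq s -> i \in s ->
    (forall j y, j != i -> W y -> W (V j y)) -> W x ->
  exists2 z, W z & mpow s k x = iter (k i) (V i) z.
Proof.
move=> + + VW Wx; elim: s => //= j s IHs /andP[js us]; rewrite inE.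
rewrite mpow_cons; case: eqVneq => [ij _|ij /= /(IHs us) [z Wz ->]].
  exists (mpow s k x); last by rewrite ij.
  apply: mpow_closed => // i' y i's; apply: VW.
  by apply: contraNneq js => ii'; rewrite -ij -ii'.
exists (iter (k j) (V j) z); last by rewrite iter_comm.
by elim: (k j) => //= a; apply: VW; rewrite eq_sym.
Qed.

(** A preimage is built by applying the adjoints one after another; each step stays in W, where V_i
    undoes its adjoint. *)
Lemma mpow_surjective s k W x :
    (forall i y, i \in s -> W y ->
       W (adjoint (V i) y) /\ V i (adjoint (V i) y) = y) ->
  W x -> exists2 z, W z & mpow s k z = x.
Proof.
move=> + ; elim: s x => [|i s IHs] x VW Wx; first by exists x; rewrite ?mpow_nil.
have [y Wy <-] : exists2 y, W y & iter (k i) (V i) y = x.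
  elim: (k i) => [|a [y Wy <-]]; first by exists x.
  have [Wy' yE] := VW i y (mem_head _ _) Wy.
  by exists (adjoint (V i) y) => //; rewrite iterSr yE.
have [|z Wz <-] := IHs y _ Wy; last by exists z; rewrite ?mpow_cons.
by move=> j z js; apply: VW; rewrite inE js orbT.
Qed.

(** The other isometries preserve the kernel of [adjoint (V i)], so bringing the power of V_i to the
    front on both sides reduces the claim to a single isometry. *)
Lemma mpow_orthogonal i s k l x y : uniq s -> i \in s -> k i <> l i ->
    adjoint (V i) x = 0 -> adjoint (V i) y = 0 ->
  inner (mpow s k x) (mpow s l y) = 0.
Proof.
move=> us si kl x0 y0.
have kerV j z : j != i -> adjoint (V i) z = 0 -> adjoint (V i) (V j z) = 0.
  by move=> ji; have /reducingP [_ + _] := reducing_ker_adjoint ji; apply.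
have [x' x'0 ->] := mpow_factor k us si kerV x0.
have [y' y'0 ->] := mpow_factor l us si kerV y0.
exact: iter_ker_adjoint_orthogonal.
Qed.

(** Induction on s: the case of one isometry leaves the vectors of X killed by [adjoint (V i)]. The
    remaining V_j still reduce this subspace, and the induction hypothesis applies with the preimage
    of M under a power of V_i. *)
Lemma shift_parts_span s X M : uniq s -> (forall i, i \in s -> reducing (V i) X) ->
    (forall i, i \in s -> X `<=` shift_part (V i)) -> closed_subspace M ->
    (forall k x, X x -> (forall i, i \in s -> adjoint (V i) x = 0) ->
       M (mpow s k x)) ->
  X `<=` M.
Proof.
elim: s X M => [|i s IHs] X M /=.
  move=> _ _ _ _ XM x Xx; have := XM (fun=> 0%N) x Xx.
  by rewrite mpow_nil; apply.
move=> /andP[is_ us] redX XS clM XM.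
have si := mem_head i s; have ss j : j \in s -> j \in i :: s.
  by rewrite inE => ->; rewrite orbT.
apply: (shift_part_span (isoV i)) => //; [exact: redX | exact: XS |].
move=> a w Xw w0; have [linVa isoVa] := linear_isometry_iter a (isoV i).
apply: (IHs (X `&` [set x | adjoint (V i) x = 0]) (iter a (V i) @^-1` M)) => //.
- move=> j js; apply: reducingI => //; first exact/redX/ss.
  by apply: reducing_ker_adjoint; apply: contraNneq is_ => <-.
- by move=> j js x [Xx _]; apply: XS => //; exact: ss.
- by apply: closed_subspace_preimage => // x; rewrite isoVa.
(* Since i does not occur in s, giving it the exponent a leaves the factors over s unchanged. *)
- move=> k x [Xx x0] xs /=; pose k' j := if j == i then a else k j.
  have -> : iter a (V i) (mpow s k x) = mpow (i :: s) k' x.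
    rewrite mpow_cons /k' eqxx; congr iter; rewrite /mpow.
    congr (_ x); apply: eq_big_seq => j js.
    by case: eqVneq js is_ => [->|//] ->.
  by apply: XM => // j; rewrite inE => /predU1P[->//|]; exact: xs.
Qed.

End DoublyCommuting.

(** * Shift and unitary restrictions versus the Wold summands *)

Section ShiftAndUnitary.
Variables (R : realType) (H : hilbertType R) (T : H -> H).
Hypothesis isoT : linear_isometry T.
Implicit Types (x y : H) (X : set H).

Lemma shift_on_reducing X :
  reducing T X -> X `<=` shift_part T -> shift_on X T.
Proof.
move=> redX XS; have /reducingP [clX TX aX] := redX.
split; first by split=> [_ [x Xx <-]|x _]; [exact: TX | exact: isoT.2].
pose W := X `&` [set x | adjoint T x = 0].
have clW : closed_subspace W.
  by apply: closed_subspaceI => //; exact: closed_ker_adjoint.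
have WO k l : k <> l -> orthogonal_sets (iter k T @` W) (iter l T @` W).
  move=> kl _ _ [x [_ x0] <-] [y [_ y0] <-].
  exact: iter_ker_adjoint_orthogonal.
exists W; split => //; first by move=> x [].
split=> // [k|].
  by apply: closed_isometry_image => //; exact: linear_isometry_iter.
rewrite eqEsubset; split.
  apply: (shift_part_span isoT) => //; first exact: closed_span_closed.
  by move=> k w Xw w0; apply: sub_closed_span; exists k => //; exists w.
apply: closed_span_sub => // _ [k _ [x [Xx _] <-]].
by elim: k => //= k; exact: TX.
Qed.

Lemma unitary_on_reducing X :
  reducing T X -> X `<=` unit_part T -> unitary_on X T.
Proof.
move=> /reducingP [clX TX aX] XU; split; last first.
  by move=> x y _ _; exact: linear_isometry_inner.
split=> [x Xx|x y _ _ Txy|x Xx]; first exact: TX.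
  by rewrite -(adjointK isoT x) Txy adjointK.
by exists (adjoint T x); [exact: aX | exact/unit_partK/XU].
Qed.

(** T maps X into the closed span of the T^k W with k > 0, which is orthogonal to W; hence W lies in
    the kernel of [adjoint T]. This kernel is inside the shift part, which is closed and invariant
    under T. *)
Lemma sub_shift_part X : reducing T X -> shift_on X T -> X `<=` shift_part T.
Proof.
move=> /reducingP [clX TX aX] [_ [W [WX [clW WO] [_ _ XE]]]].
have W_ker w : W w -> adjoint T w = 0.
  move=> Ww; apply: inner_eq0; rewrite -adjointP//; apply: inner_eq0C.
  pose Y := T @^-1` orthocomplement [set w].
  suff XY : X `<=` Y by apply: inner_eq0C; apply: (XY _ (aX _ (WX _ Ww))).
  rewrite XE; apply: closed_span_sub.
    apply: closed_subspace_preimage; first exact: isoT.1; last first.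
      exact: closed_orthocomplement.
    by move=> x; rewrite isoT.2.
  move=> _ [k _ [v Wv <-]] _ /= ->.
  by apply: (WO k.+1 0%N) => //; [exists v | exists w].
rewrite XE; apply: closed_span_sub; first exact: closed_orthocomplement.
move=> _ [k _ [w Ww <-]]; have Sw := ker_adjoint_shift_part isoT (W_ker w Ww).
have /reducingP [_ TS _] := reducing_shift_part isoT.
by elim: k => //= k; exact: TS.
Qed.

Lemma sub_unit_part_of_unitary X : unitary_on X T -> X `<=` unit_part T.
Proof.
move=> [[_ _ surjT] _]; apply: sub_unit_part => x /surjT [y Xy <-];
by rewrite adjointK.
Qed.

End ShiftAndUnitary.

(** * The components of a tuple: formula, direct sum and uniqueness *)

Section Tuples.
Variables (R : realType) (H : hilbertType R) (m : nat).
Variable V : 'I_m -> {linear H -> H}.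
Hypothesis dcV : doubly_commuting_isometries V.
Implicit Types (x y : H) (X : set H) (A B : {set 'I_m}).

Let VF (i : 'I_m) : H -> H := V i.

Lemma doubly_commuting_isometriesW : doubly_commuting_family VF.
Proof.
case: dcV => isoV VC aVC; have isoV' i : linear_isometry (VF i).
  split; first by move=> a x y; rewrite /VF linearP.
  by move=> x; have [_ ->] := isoV i.
split=> // [i j x|i j ij x]; first exact: (congr1 (@^~ x) (VC i j)).
have [lt_ij|] := ltnP i j; first exact: (congr1 (@^~ x) (aVC i j lt_ij)).
rewrite leq_eqVlt => /orP[/eqP/val_inj ji|lt_ji].
  by rewrite ji eqxx in ij.
(* For j < i the relation follows from the one for the pair j, i by passing to adjoints. *)
apply: inner_extr => y; rewrite -[RHS]adjointP// -adjointPl//.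
have /(congr1 (@^~ y)) /= aVCji := aVC j i lt_ji.
rewrite -[LHS]adjointP// -[RHS]adjointPl//; exact: (congr1 (inner^~ x)).
Qed.
Let dcF := doubly_commuting_isometriesW.
Let isoV : forall i, linear_isometry (VF i) := dc_isometry dcF.

Definition wold_space A : set H := \bigcap_i wold_part VF (i \in A) i.

Lemma reducing_wold_space i A : reducing (V i) (wold_space A).
Proof. by apply: reducing_bigcap => j; exact: (reducing_wold_part dcF). Qed.

Lemma closed_wold_space A : closed_subspace (wold_space A).
Proof.
apply: closed_subspace_bigcap => i _.
by have [] := reducing_wold_part dcF (i \in A) i i.
Qed.

(** Each factor projects onto the kernel of one adjoint. The factor for i lands in the kernel of
    [adjoint (V i)] and the others preserve it; conversely, the product fixes every vector lying in
    all these kernels. *)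
Lemma wandering_rangeE A :
  wandering_range V A = [set x | forall i, i \in A -> adjoint (V i) x = 0].
Proof.
have [_ _ aVC] := dcF.
have lin_a i : linear (adjoint (VF i)) by exact: adjoint_linear.
rewrite eqEsubset; split=> [_ [x _ <-] i iA|x xA]; last first.
  exists x => //; elim: (index_enum _) => [|i s IHs]; first by rewrite big_nil.
  rewrite big_cons; case: ifP => //= iA.
  by rewrite IHs xA// linear0 subr0.
move: (mem_index_enum i); elim: (index_enum _) => // j s IHs.
rewrite inE big_cons; case: eqVneq => [<- _|ij /= /IHs s0].
  by rewrite iA /=; exact: (adjoint_defect (isoV i)).
case: ifP => //= jA; set y := bigop _ _ _ x in s0 *.
rewrite (linB (lin_a i)).
have := aVC j i; rewrite eq_sym => /(_ ij); rewrite /VF => <-.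
have -> : adjoint (V i) (adjoint (V j) y) = adjoint (V j) (adjoint (V i) y).
  exact: (adjoint_comm dcF).
by rewrite s0 (lin0 (lin_a j)) linear0 subrr.
Qed.

(** A description of [unitary_core] free of multi-indices. *)
Definition wold_core A : set H :=
  [set x | (forall i, i \in A -> adjoint (V i) x = 0) /\
           (forall i, i \notin A -> unit_part (V i) x)].

Lemma doubly_commuting_sub A :
  doubly_commuting_family (fun i : {i | i \in A} => VF (val i)).
Proof. by have [isoV' VC aVC] := dcF; split=> // i j ij; apply: aVC. Qed.

Lemma unitary_coreE A : unitary_core V A = wold_core A.
Proof.
rewrite /unitary_core wandering_rangeE eqEsubset; split=> x.
  move=> core; split=> [i iA|i iA a _].
    (* The zero multi-index has the identity as its power, so x itself is in the wandering range. *)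
    pose k0 : multi_index (~: A) := [ffun=> 0%N].
    have [w /= wA <-] := core k0 I.
    suff -> : multi_power V k0 w = w by exact: wA.
    rewrite /multi_power; elim: (index_enum _) => [|j s IHs].
      by rewrite big_nil.
    by rewrite big_cons /= ffunE IHs.
  have iC : i \in ~: A by rewrite inE.
  (* The constant multi-index a places x in the range of the a-th power of V_i. *)
  pose ka : multi_index (~: A) := [ffun=> a].
  have [w _ <-] := core ka I.
  have [||z _ zE] := @mpow_factor _ _ _ _ (doubly_commuting_sub (~: A))
    (exist _ i iC) (index_enum _) ka setT w (index_enum_uniq _) _ _ I.
  - exact: mem_index_enum.
  - by [].
  by exists z => //; rewrite [RHS]zE ffunE.
move=> [xA xU] k _.
(* Outside A the adjoints preserve [wold_core A] and are undone there by V_i, so x has a preimage in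
   it under every joint power. *)
have [|z [zA zU] zE] := @mpow_surjective _ _ _
  (fun i : {i | i \in ~: A} => VF (val i)) (index_enum _) k (wold_core A) x _
  (conj xA xU).
  move=> [i iC] y _ [yA yU]; have iA : i \notin A by rewrite inE in iC.
  split; last by apply: (unit_partK (isoV i)); exact: yU.
  split=> [j jA|j jA] /=.
    have -> : adjoint (V j) (adjoint (VF i) y)
        = adjoint (VF i) (adjoint (V j) y).
      exact: (adjoint_comm dcF).
    by rewrite yA// lin0//; exact: adjoint_linear.
  have /reducingP [_ _] := reducing_unit_partF dcF i j; apply; exact: yU.
by exists z.
Qed.

Lemma wold_core_sub A : wold_core A `<=` wold_space A.
Proof.
move=> x [xA xU] i _; rewrite /wold_part; case: ifPn => [/xA x0|/xU //].
exact: (ker_adjoint_shift_part (isoV i)).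
Qed.

Lemma wold_coreI A :
  wold_core A =
  wold_space A `&` [set x | forall i, i \in A -> adjoint (V i) x = 0].
Proof.
rewrite eqEsubset; split=> [x Ax|x [Ax xA]].
  by split; [exact: wold_core_sub | case: Ax].
by split=> // i iA; have := Ax i I; rewrite /wold_part (negbTE iA).
Qed.

Lemma closed_wold_core A : closed_subspace (wold_core A).
Proof.
rewrite wold_coreI; apply: closed_subspaceI; first exact: closed_wold_space.
by apply: closed_subspace_bigcap => i _; exact: (closed_ker_adjoint (isoV i)).
Qed.

(** Distinct multi-indices differ at some i in A, and the core is killed by [adjoint (V i)]: this
    gives orthogonality. Spanning holds because the component lies in the shift part of every V_i
    with i in A. *)
Lemma wold_space_component A : wold_component V A (wold_space A).
Proof.
have dcA := doubly_commuting_sub A.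
rewrite /wold_component unitary_coreE; split=> [k|k l kl|].
- apply: closed_isometry_image; last exact: closed_wold_core.
  exact: (linear_isometry_mpow dcA).
- move=> _ _ [x [xA _] <-] [y [yA _] <-].
  have [[i iA] /eqP kli] : exists i, k i != l i.
    apply/existsP; apply: contra_notT kl => /existsPn kl.
    by apply/ffunP => i; apply/eqP; rewrite -[_ == _]negbK.
  apply: (mpow_orthogonal dcA (index_enum_uniq _) (mem_index_enum _) kli).
    exact: xA.
  exact: yA.
- have redA i x : wold_space A x -> wold_space A (V i x).
    by have /reducingP [_ + _] := reducing_wold_space i A; apply.
  rewrite eqEsubset; split; last first.
    apply: closed_span_sub; first exact: closed_wold_space.
    move=> _ [k _ [x /wold_core_sub Ax <-]].
    exact: (@mpow_closed _ _ _ (fun i : {i | i \in A} => VF (val i)) _ k _ _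
      (fun i y _ => redA (val i) y)).
  apply: (shift_parts_span dcA (index_enum_uniq _)).
  + by move=> i _; exact: reducing_wold_space.
  + by move=> [i iA] _ x /(_ i I); rewrite /wold_part iA.
  + exact: closed_span_closed.
  + move=> k x Ax x0; apply: sub_closed_span; exists (finfun k) => //.
    exists x.
      rewrite wold_coreI; split=> // i iA.
      by apply: (x0 (exist _ i iA)); rewrite mem_index_enum.
    congr (_ x); rewrite /multi_power.
    by apply: eq_bigr => i _; rewrite ffunE.
Qed.

Lemma wold_space_dsum : orthogonal_dsum wold_space setT.
Proof.
split=> [A|A B AB|]; first exact: closed_wold_space.
  (* By symmetry some i is in A but not in B; the two components then lie in the shift part and the
     unitary part of V_i. *)
  wlog [i iA iB] : A B AB / exists2 i, i \in A & i \notin B.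
    move=> Hw; have [/subsetPn|sAB] := boolP (~~ (A \subset B)).
      exact: Hw.
    have [i iB iA] : exists2 i, i \in B & i \notin A.
      apply/subsetPn; apply: contra_notN AB => sBA.
      by apply/eqP; rewrite finset.eqEsubset (negbNE sAB) sBA.
    move=> x y Ax By; apply: inner_eq0C; apply: (Hw B A) => //.
      exact: nesym.
    by exists i.
  move=> x y /(_ i I) + /(_ i I); rewrite /wold_part iA (negbTE iB) => Sx.
  exact: Sx.
rewrite eqEsubset; split=> // x _.
apply: (wold_parts_span dcF (s := index_enum _) _ _ _ (I : setT x)).
- move=> i; apply/reducingP; split=> //; exact: closed_subspace_setT.
- exact: closed_span_closed.
- move=> b y [_ yb]; apply: sub_closed_span; exists [set i | b i]%SET => // i _.
  by rewrite inE; apply: yb; rewrite mem_index_enum.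
Qed.

Lemma wold_space_decomposition : shift_unitary_decomposition V wold_space.
Proof.
split=> [A i||A _ i]; [exact: reducing_wold_space | exact: wold_space_dsum |].
split=> iA.
  apply: (shift_on_reducing (isoV i)); first exact: reducing_wold_space.
  by move=> x /(_ i I); rewrite /wold_part iA.
apply: (unitary_on_reducing (isoV i)); first exact: reducing_wold_space.
by move=> x /(_ i I); rewrite /wold_part (negbTE iA).
Qed.

Lemma shift_unitary_decomposition_unique (HA : {set 'I_m} -> set H) :
  shift_unitary_decomposition V HA -> HA = wold_space.
Proof.
move=> [redHA [clHA _ HAT] suHA].
have HA_sub A : HA A `<=` wold_space A.
  (* The hypothesis says nothing about the restrictions to a zero component, but {0} is contained in
     any closed subspace. *)
  move=> x Ax i _; have [A0|/suHA /(_ i) [shA unA]] := pselect (HA A = [set 0]).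
    move: Ax; rewrite A0 => ->; apply: csub0.
    by have [] := reducing_wold_part dcF (i \in A) i i.
  rewrite /wold_part; case: ifPn => iA.
    exact: (sub_shift_part (isoV i) (redHA A i) (shA iA)).
  exact: (sub_unit_part_of_unitary (isoV i) (unA iA)).
have [_ orthW _] := wold_space_dsum.
apply/funext => A; rewrite eqEsubset; split; first exact: HA_sub.
move=> x Ax; have [p [q [Ap qP xE]]] := orthogonal_decomposition x (clHA A).
have Aq : wold_space A q.
  have -> : q = x - p by rewrite xE addrC addKr.
  by apply: (csubB (closed_wold_space A)) => //; exact: HA_sub.
(* The remainder q is orthogonal to H_A by construction and to every other H_B because H_B lies in
   the component of B. These span the space, so q is orthogonal to itself. *)
suff q0 : orthocomplement [set q] q.
  by rewrite xE (orthocomplement_disj (X := [set q]) erefl q0) addr0.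
have : [set: H] q by [].
rewrite HAT; apply: closed_span_sub; first exact: closed_orthocomplement.
move=> y [B _ By] _ /= ->; apply: inner_eq0C.
have [BA|/eqP BA] := eqVneq B A; first by apply: qP; rewrite -BA.
by apply: (orthW A B) => //; [exact: nesym | exact: HA_sub].
Qed.

End Tuples.

Theorem theorem3p1 (R : realType) (H : hilbertType R) (n : nat)
    (V : 'I_n -> {linear H -> H}) :
  (2 <= n)%N -> doubly_commuting_isometries V ->
  [/\ forall (m : nat) (le_mn : (m <= n)%N), (2 <= m)%N ->
        let Vm := fun i : 'I_m => V (widen_ord le_mn i) in
        exists HA : {set 'I_m} -> set H,
          [/\ forall A, jointly_reducing Vm (HA A),
              orthogonal_dsum HA setT
            & forall A, wold_component Vm A (HA A)],
      exists HA : {set 'I_n} -> set H, shift_unitary_decomposition V HA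
    & forall HA : {set 'I_n} -> set H, shift_unitary_decomposition V HA ->
        forall A, wold_component V A (HA A)].
Proof.
move=> _ dcV; split=> [m le_mn _ Vm||HA decHA A].
- have dcVm : doubly_commuting_isometries Vm.
    have [isoV VC aVC] := dcV.
    by split=> *; [exact: isoV | exact: VC | exact: aVC].
  exists (wold_space Vm); split=> [A i||A].
  + exact: reducing_wold_space.
  + exact: wold_space_dsum.
  + exact: wold_space_component.
- by exists (wold_space V); exact: wold_space_decomposition.
- rewrite (shift_unitary_decomposition_unique dcV decHA).
  exact: wold_space_component.
Qed.
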